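(* Let $N\in\mathbb{N}$, $p=4N$, let $X\in\mathbb{R}^{n\times4N}$ be a fair design, and let $\beta^0\in\mathbb{R}^{4N}$ have active set $S_0=\{1,\ldots,2N\}$, so $S_0^c=\{2N+1,\ldots,4N\}$. Suppose for $k=1,\ldots,N$ $$(X_{2k-1},X_{2k})^T(X_{2k-1},X_{2k})=\begin{pmatrix}1&-\hat\rho_k\\-\hat\rho_k&1\end{pmatrix},\qquad\hat\varphi_k^2:=1-\hat\rho_k,\quad0<\hat\rho_k<1,$$ and $X_{2k-1},X_{2k}$ are orthogonal to $\{X_j\}_{j\in S_0\setminus\{2k-1,2k\}}$. For $k=1,\ldots,N$ let $$X_{2N+2k-1}=C_k(X_{2k-1}+X_{2k})/2+U_k+V_k,\qquad X_{2N+2k}=C_k(X_{2k-1}+X_{2k})/2+U_k-V_k,$$ where $C_k>1$ and $C_k^2\hat\varphi_k^2/2<1$, the vectors $U_k,V_k$ are orthogonal to $\{X_j\}_{j\in S_0}$ as well as to $\{U_j,V_j\}_{j\ne k}$, and $U_k^TV_k=0$. Let $\hat\tau_k^2:=U_k^TU_k$ with $0<\hat\tau_k^2<1-C_k^2\hat\varphi_k^2/2$. Then $$\hat\Gamma^2(S_0)=2\sum_{k=1}^N1/\hat\varphi_k^2+\sum_{k=1}^NC_k^2/\hat\tau_k^2.$$ If $\lambda>0$ and, for $k=1,\ldots,N$, $\beta_{2k-1}^0\ge\beta_{2k}^0\ge\lambda/\hat\varphi_k^2+\lambda C_k(C_k-1)/(2\hat\tau_k^2)$, then the noiseless Lasso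 $\beta^*$ satisfies $$\|X(\beta^*-\beta^0)\|_2^2+2\lambda\|\beta_{-S_0}^*\|_1=\lambda^2\hat\Gamma^2(S_0)-\lambda^2\|1/\hat\tau^2\|_1.$$
   Context: Fair design: all columns satisfy $\|X_j\|_2=1$ and there are no $j\ne k$ and constant $b$ with $X_j=bX_k$. The noiseless Lasso is $\beta^*:=\arg\min_{\beta\in\mathbb{R}^p}\{\|X(\beta-\beta^0)\|_2^2+2\lambda\|\beta\|_1\}$. Here $\|1/\hat\tau^2\|_1:=\sum_{k=1}^N1/\hat\tau_k^2$. For $S\subset\{1,\ldots,p\}$, $\beta_S$ is the vector with entries $\beta_j$ for $j\in S$ and $0$ otherwise, and $\beta_{-S}:=\beta_{S^c}$. The compatibility constant is $\hat\phi^2(S):=\min\{|S|\,\|X\beta\|_2^2:\ \|\beta_S\|_1=1,\ \|\beta_{-S}\|_1\le1\}$, and the effective sparsity is $\hat\Gamma^2(S):=|S|/\hat\phi^2(S)$. *)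

(* Defs.v *)
From HB Require Import structures.
From mathcomp Require Import all_boot all_order all_algebra.
From mathcomp Require Import mathcomp_extra boolp classical_sets reals.
From mathcomp Require Import topology normedtype derive zify.

Set Implicit Arguments.
Unset Strict Implicit.
Unset Printing Implicit Defensive.

Import Order.TTheory GRing.Theory Num.Theory.
Import numFieldNormedType.Exports.

Local Open Scope ring_scope.

Definition dot (R : realType) (n : nat) (u v : 'cV[R]_n) : R :=
  (u^T *m v) ord0 ord0.

(* The norm carried by 'cV[R]_n in the library is the sup norm, hence these. *)
Definition l2norm (R : realType) (n : nat) (v : 'cV[R]_n) : R :=
  Num.sqrt (\sum_i v i ord0 ^+ 2).

Definition l1norm (R : realType) (p : nat) (b : 'cV[R]_p) : R :=
  \sum_j `|b j ord0|.

Definition restrict_to (R : realType) (p : nat) (S : {set 'I_p})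
    (b : 'cV[R]_p) : 'cV[R]_p :=
  \col_j (if j \in S then b j ord0 else 0).

Definition active_set (R : realType) (p : nat) (b : 'cV[R]_p) : {set 'I_p} :=
  [set j | b j ord0 != 0]%SET.

Definition fair_design (R : realType) (n p : nat) (X : 'M[R]_(n, p)) : Prop :=
  (forall j, l2norm (col j X) = 1) /\
  (forall j k, j != k -> ~ exists b : R, col j X = b *: col k X).

Definition compat_feasible (R : realType) (p : nat) (S : {set 'I_p}) :
    set 'cV[R]_p :=
  [set b : 'cV[R]_p | l1norm (restrict_to S b) = 1 /\
                      l1norm (restrict_to (~: S)%SET b) <= 1]%classic.

Arguments compat_feasible R {p} S.

(* phi^2(S); for nonempty S the infimum is a minimum, see compat_const_min. *)
Definition compat_const (R : realType) (n p : nat) (X : 'M[R]_(n, p))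
    (S : {set 'I_p}) : R :=
  inf [set #|S|%:R * l2norm (X *m b) ^+ 2 | b in compat_feasible R S]%classic.

(* Gamma^2(S). For empty S this is 0 / _ = 0. *)
Definition effective_sparsity (R : realType) (n p : nat) (X : 'M[R]_(n, p))
    (S : {set 'I_p}) : R :=
  #|S|%:R / compat_const X S.

Definition lasso_obj (R : realType) (n p : nat) (X : 'M[R]_(n, p))
    (beta0 : 'cV[R]_p) (lambda : R) (b : 'cV[R]_p) : R :=
  l2norm (X *m (b - beta0)) ^+ 2 + 2 * lambda * l1norm b.

(* The set of all minimizers, nonempty by noiseless_lasso_exists. *)
Definition noiseless_lasso (R : realType) (n p : nat) (X : 'M[R]_(n, p))
    (beta0 : 'cV[R]_p) (lambda : R) : set 'cV[R]_p :=
  [set b : 'cV[R]_p | forall b' : 'cV[R]_p,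
     lasso_obj X beta0 lambda b <= lasso_obj X beta0 lambda b']%classic.

(* Columns are numbered from 0: for k = 0, ..., N-1 the indices
   2k, 2k+1, 2N+2k, 2N+2k+1 stand for 2k-1, 2k, 2N+2k-1, 2N+2k with
   k = 1, ..., N in 1-based numbering. *)
Lemma act_proof (N : nat) (k : 'I_N) (e : bool) : (2 * k + e < 4 * N)%N.
Proof. have := ltn_ord k; case: e; lia. Qed.

Lemma inact_proof (N : nat) (k : 'I_N) (e : bool) :
  (2 * N + (2 * k + e) < 4 * N)%N.
Proof. have := ltn_ord k; case: e; lia. Qed.

Definition act1 (N : nat) (k : 'I_N) : 'I_(4 * N) :=
  Ordinal (act_proof k false).
Definition act2 (N : nat) (k : 'I_N) : 'I_(4 * N) :=
  Ordinal (act_proof k true).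
Definition inact1 (N : nat) (k : 'I_N) : 'I_(4 * N) :=
  Ordinal (inact_proof k false).
Definition inact2 (N : nat) (k : 'I_N) : 'I_(4 * N) :=
  Ordinal (inact_proof k true).

Lemma l2norm_sqr (R : realType) (n : nat) (v : 'cV[R]_n) :
  l2norm v ^+ 2 = \sum_i v i ord0 ^+ 2.
Proof. by rewrite /l2norm sqr_sqrtr // sumr_ge0 // => i _; rewrite sqr_ge0. Qed.

Lemma l1norm_ge_coord (R : realType) (p : nat) (b : 'cV[R]_p) (j : 'I_p) :
  `|b j ord0| <= l1norm b.
Proof. by rewrite /l1norm (bigD1 j) //= lerDl sumr_ge0. Qed.

Lemma continuous_sum_ord (R : realType) (T : topologicalType) (m : nat)
    (F : 'I_m -> T -> R) :
  (forall i, continuous (F i)) -> continuous (fun v => \sum_i F i v).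
Proof. by move=> cF; apply: continuous_big => //; exact: add_continuous. Qed.

Lemma continuous_l1norm_restrict (R : realType) (p : nat) (S : {set 'I_p}) :
  continuous (fun v : 'rV[R]_p => l1norm (restrict_to S v^T)).
Proof.
apply: continuous_sum_ord => j v.
rewrite (_ : (fun _ => _) =
  (fun w : 'rV[R]_p => `|if j \in S then w ord0 j else 0|)); last first.
  by apply/funext => w; rewrite !mxE.
apply: (@continuous_comp _ _ _ _ (fun x : R => `|x|)); last exact: norm_continuous.
case: (j \in S); [exact: coord_continuous | exact: cst_continuous].
Qed.

Lemma continuous_l2norm_sqr (R : realType) (n p : nat) (X : 'M[R]_(n, p))
    (c : 'cV[R]_p) :
  continuous (fun v : 'rV[R]_p => l2norm (X *m (v^T - c)) ^+ 2).
Proof.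
under eq_fun do rewrite l2norm_sqr.
apply: continuous_sum_ord => i v.
rewrite (_ : (fun _ => _) = (fun w : 'rV[R]_p =>
    (\sum_j X i j * (w ord0 j - c j ord0)) * (\sum_j X i j * (w ord0 j - c j ord0)))); last first.
  apply/funext => w; rewrite expr2 mxE.
  by congr (_ * _); apply: eq_bigr => j _; rewrite !mxE.
have cF : continuous (fun w : 'rV[R]_p => \sum_j X i j * (w ord0 j - c j ord0)).
  apply: continuous_sum_ord => j w.
  apply: (@cvgMl_tmp _ _ (nbhs w)).
  apply: (@cvgB _ _ _ (nbhs w)); [exact: coord_continuous | exact: cvg_cst].
exact: (@cvgM _ _ (nbhs v) _ _ _ _ _ (cF v) (cF v)).
Qed.

Lemma compact_box (R : realType) (p : nat) (M : R) :
  compact [set v : 'rV[R]_p | forall j, `[- M, M]%classic (v ord0 j)]%classic.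
Proof. 
apply: (@rV_compact R p (fun=> `[- M, M]%classic)) => j.
exact: segment_compact.
 Qed.

Lemma compat_const_min (R : realType) (n p : nat) (X : 'M[R]_(n, p))
    (S : {set 'I_p}) : S != finset.set0 ->
  exists2 b, compat_feasible R S b &
    compat_const X S = #|S|%:R * l2norm (X *m b) ^+ 2 /\
    forall b', compat_feasible R S b' ->
      compat_const X S <= #|S|%:R * l2norm (X *m b') ^+ 2.
Proof.
case/set0Pn => j0 j0S.
pose A := [set v : 'rV[R]_p | compat_feasible R S v^T]%classic.
have A0 : (A !=set0)%classic.
  exists (delta_mx ord0 j0); split.
    rewrite /l1norm (bigD1 j0) //= big1 ?addr0; last first.
      by move=> j jj0; rewrite !mxE (negbTE jj0) /= if_same normr0.
    by rewrite !mxE j0S !eqxx normr1.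
  rewrite /l1norm big1 // => j _; rewrite !mxE inE.
  by case: (eqVneq j j0) => [->|_]; rewrite ?j0S //= ?if_same normr0.
have clA : closed A.
  rewrite (_ : A = (fun v : 'rV[R]_p => l1norm (restrict_to S v^T)) @^-1` [set x | x = 1]
     `&` (fun v : 'rV[R]_p => l1norm (restrict_to (~: S)%SET v^T)) @^-1` [set x | x <= 1])%classic //.
  apply: closedI; apply: preimage_closed => [v _|].
  - exact: continuous_l1norm_restrict.
  - exact: closed_eq.
  - exact: continuous_l1norm_restrict.
  - exact: closed_le.
have cA : compact A.
  apply: subclosed_compact clA (@compact_box R p 1) _ => v [hS hC] j /=.
  rewrite in_itv /= -ler_norml; case: (boolP (j \in S)) => jS.
    by have := l1norm_ge_coord (restrict_to S v^T) j; rewrite hS !mxE jS.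
  apply: le_trans hC; have := l1norm_ge_coord (restrict_to (~: S)%SET v^T) j.
  by rewrite !mxE inE jS.
have [|c cA' cmin] := EVT_min_rV (f := fun v : 'rV[R]_p => l2norm (X *m (v^T - 0)) ^+ 2) A0 cA.
  exact/continuous_subspaceT/continuous_l2norm_sqr.
have {}cmin (b : 'cV[R]_p) : compat_feasible R S b ->
    #|S|%:R * l2norm (X *m c^T) ^+ 2 <= #|S|%:R * l2norm (X *m b) ^+ 2.
  move=> hb; have := cmin b^T; rewrite !inE /A /= trmxK !subr0 => /(_ hb).
  exact: ler_wpM2l.
have cF : compat_feasible R S c^T by move: cA'; rewrite inE.
have E : compat_const X S = #|S|%:R * l2norm (X *m c^T) ^+ 2.
  apply/eqP; rewrite eq_le; apply/andP; split.
    apply: ge_inf; last by exists c^T.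
    by exists (#|S|%:R * l2norm (X *m c^T) ^+ 2) => _ [b hb <-]; exact: cmin.
  apply: lb_le_inf; first by exists (#|S|%:R * l2norm (X *m c^T) ^+ 2); exists c^T.
  by move=> _ [b hb <-]; exact: cmin.
by exists c^T => //; split => // b' hb'; rewrite E; exact: cmin.
Qed.

Lemma noiseless_lasso_exists (R : realType) (n p : nat) (X : 'M[R]_(n, p))
    (beta0 : 'cV[R]_p) (lambda : R) : 0 < lambda ->
  exists b, noiseless_lasso X beta0 lambda b.
Proof.
move=> l0; pose f := lasso_obj X beta0 lambda.
have f_ge (b : 'cV[R]_p) j : 2 * lambda * `|b j ord0| <= f b.
  rewrite /f /lasso_obj -[leLHS]add0r lerD ?sqr_ge0 //.
  by rewrite ler_wpM2l ?l1norm_ge_coord // mulr_ge0 // ltW.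
pose M := f 0 / (2 * lambda).
have l20 : 0 < 2 * lambda by rewrite mulr_gt0.
have f0 : 0 <= f 0.
  by rewrite addr_ge0 ?sqr_ge0 // mulr_ge0 ?(ltW l20) // sumr_ge0.
have M0 : 0 <= M by rewrite divr_ge0 // ltW.
pose A := [set v : 'rV[R]_p | forall j, `[- M, M]%classic (v ord0 j)]%classic.
have A0 : A 0 by move=> j; rewrite /= mxE in_itv /= oppr_le0 M0.
have cl : continuous (fun v : 'rV[R]_p => l1norm v^T).
  rewrite (_ : (fun _ => _) =
    fun w : 'rV[R]_p => l1norm (restrict_to [set: 'I_p]%SET w^T)).
    exact: continuous_l1norm_restrict.
  by apply/funext => w; apply: eq_bigr => j _; rewrite !mxE inE.
have cf : continuous (fun v : 'rV[R]_p => f v^T).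
  move=> v; apply: (@cvgD _ _ _ (nbhs v)); first exact: continuous_l2norm_sqr.
  by apply: (@cvgMl_tmp _ _ (nbhs v)); exact: cl.
have [|c _ cmin] := EVT_min_rV (ex_intro _ _ A0) (@compact_box R p M) (f := fun v => f v^T).
  exact/continuous_subspaceT/cf.
exists c^T => b; rewrite -/(f _) -/(f _).
have [hb|/existsNP[j hb]] := pselect (A b^T).
  by rewrite -[b in leRHS]trmxK; apply: cmin; rewrite inE.
apply: (@le_trans _ _ (f 0)).
  by rewrite -[0 in leRHS]trmxK trmx0; apply: cmin; rewrite inE.
apply: le_trans (f_ge b j); rewrite leNgt; apply/negP => hlt; apply: hb.
rewrite /= in_itv /= -ler_norml mxE.
by rewrite /M ler_pdivlMr // mulrC ltW.
Qed.

(* Main.v *)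
(* The four columns indexed by k span blocks that are pairwise orthogonal, so
   |X b|^2 is a sum over k of a quadratic form which is diagonal in a + b + C s,
   a - b, s = c + d and c - d, where (a, b) are the active and (c, d) the inactive
   coefficients of the block.

   Effective sparsity: by Young's inequality each block satisfies
   Q >= 2 t (|a| + |b|) - t^2 (2 / phi^2 + C^2 / tau^2) for t >= 0. Summing over
   k with t the inverse of G = sum_k (2 / phi^2 + C^2 / tau^2) gives |X b|^2 >= 1 / G
   on the feasible set. The point with s = - t C / tau^2 attains equality; its
   inactive l1 norm is at most 1 because C > 1.

   Lasso: replacing every |x| by x and completing squares bounds the objective
   from below by a constant plus a sum of weighted squares. The lower bound on
   beta0 makes the common zero of these squares have nonnegative coordinates, so
   the constant is attained and all squares vanish at every minimizer, whose
   coordinates are thereby known. *)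
Require Import Defs.
From HB Require Import structures.
From mathcomp Require Import all_boot all_order all_algebra.
From mathcomp Require Import boolp classical_sets reals.
From mathcomp Require Import zify ring lra.

Set Implicit Arguments.
Unset Strict Implicit.
Unset Printing Implicit Defensive.

Import Order.TTheory GRing.Theory Num.Theory.
Local Open Scope ring_scope.

(** * Bilinearity and orthogonality for the Euclidean inner product *)

Section Dot.
Context {R : realType} {n : nat}.
Implicit Types u v w : 'cV[R]_n.

Lemma dotC u v : dot u v = dot v u.
Proof. by rewrite /dot !mxE; apply: eq_bigr => i _; rewrite !mxE mulrC. Qed.

Lemma dotDl u v w : dot (u + v) w = dot u w + dot v w.
Proof. by rewrite /dot raddfD mulmxDl mxE. Qed.

Lemma dotZl (a : R) u v : dot (a *: u) v = a * dot u v.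
Proof. by rewrite /dot linearZ /= -scalemxAl mxE. Qed.

Lemma dotDr u v w : dot w (u + v) = dot w u + dot w v.
Proof. by rewrite dotC dotDl !(dotC _ w). Qed.

Lemma dotZr (a : R) u v : dot u (a *: v) = a * dot u v.
Proof. by rewrite dotC dotZl dotC. Qed.

Lemma dot_suml (I : finType) (F : I -> 'cV[R]_n) v :
  dot (\sum_i F i) v = \sum_i dot (F i) v.
Proof. by rewrite /dot raddf_sum mulmx_suml summxE. Qed.

Lemma l2norm_dot u : l2norm u ^+ 2 = dot u u.
Proof.
by rewrite l2norm_sqr /dot mxE; apply: eq_bigr => i _; rewrite !mxE expr2.
Qed.

Lemma dot_sum_orthogonal (I : finType) (F : I -> 'cV[R]_n) :
  (forall i j, i != j -> dot (F i) (F j) = 0) ->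
  dot (\sum_i F i) (\sum_i F i) = \sum_i dot (F i) (F i).
Proof.
move=> orthF; rewrite dot_suml; apply: eq_bigr => i _.
rewrite dotC dot_suml (bigD1 i) //= big1 ?addr0 // => j ji.
exact: orthF.
Qed.

End Dot.

(** * Splitting the [4 * N] coordinates into [N] blocks of four *)

Definition block_index (N : nat) (x : 'I_N * (bool * bool)) : 'I_(4 * N) :=
  if x.2.1 then Ordinal (inact_proof x.1 x.2.2)
  else Ordinal (act_proof x.1 x.2.2).

(** Both sides have [4 * N] elements, so injectivity suffices: range separates active from inactive
    indices, parity separates the two members of a pair. *)
Lemma block_index_bij (N : nat) : bijective (@block_index N).
Proof.
apply: inj_card_bij; last by rewrite !card_prod !card_bool !card_ord mulnC.
move=> [k [e f]] [k' [e' f']] /(congr1 val).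
have := ltn_ord k; have := ltn_ord k'.
have eqk : (k = k' :> nat) -> k = k' by apply: val_inj.
by case: e f e' f' => [] [] [] [] /= ? ? H; try lia; rewrite eqk //; lia.
Qed.

Lemma sum_block (V : nmodType) (N : nat) (F : 'I_(4 * N) -> V) :
  \sum_j F j =
  \sum_k (F (act1 k) + F (act2 k) + F (inact1 k) + F (inact2 k)).
Proof.
have [g hK gK] := block_index_bij N.
rewrite (reindex (@block_index N)); last by exists g => ? _.
rewrite -(pair_bigA _ (fun k e => F (block_index (k, e)))) /=.
apply: eq_bigr => k _.
rewrite -(pair_bigA _ (fun e f => F (block_index (k, (e, f))))) /=.
by rewrite !big_bool /= [in LHS]addrC [X in X + _]addrC [X in _ + X]addrC addrA.
Qed.

Lemma block_col_exists (R : realType) (N : nat) (f1 f2 f3 f4 : 'I_N -> R) :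
  exists b : 'cV[R]_(4 * N), forall k,
    [/\ b (act1 k) ord0 = f1 k, b (act2 k) ord0 = f2 k,
        b (inact1 k) ord0 = f3 k & b (inact2 k) ord0 = f4 k].
Proof.
have [g hK _] := block_index_bij N.
exists (\col_j let: (k, (e, f)) := g j in
  if e then (if f then f4 k else f3 k) else (if f then f2 k else f1 k)) => k.
have E e f : g (block_index (k, (e, f))) = (k, (e, f)) by rewrite hK.
have := (E true true, E true false, E false true, E false false).
by rewrite /block_index /= => -[[[E1 E2] E3] E4]; rewrite !mxE E1 E2 E3 E4.
Qed.

(** * Blockwise l1 norms on the active set and its complement *)

Section Restrict.
Context {R : realType} {N : nat}.
Implicit Type b : 'cV[R]_(4 * N).
Let S0 := [set j : 'I_(4 * N) | (j < 2 * N)%N]%SET.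

Lemma act_lt (k : 'I_N) : (act1 k < 2 * N)%N * (act2 k < 2 * N)%N *
  ((inact1 k < 2 * N)%N = false) * ((inact2 k < 2 * N)%N = false).
Proof. by have := ltn_ord k; rewrite /=; do !split; lia. Qed.

Lemma l1norm_block b : l1norm b =
  \sum_k (`|b (act1 k) ord0| + `|b (act2 k) ord0|
          + `|b (inact1 k) ord0| + `|b (inact2 k) ord0|).
Proof. exact: sum_block. Qed.

Lemma l1norm_active b : l1norm (restrict_to S0 b) =
  \sum_k (`|b (act1 k) ord0| + `|b (act2 k) ord0|).
Proof.
rewrite l1norm_block; apply: eq_bigr => k _.
by rewrite !mxE !inE !act_lt normr0 !addr0.
Qed.

Lemma l1norm_inactive b : l1norm (restrict_to (~: S0)%SET b) =
  \sum_k (`|b (inact1 k) ord0| + `|b (inact2 k) ord0|).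
Proof.
rewrite l1norm_block; apply: eq_bigr => k _.
by rewrite !mxE !inE !act_lt /= normr0 !add0r.
Qed.

End Restrict.

(** * The quadratic form of a single block *)

(* The squared norm of one block of [X *m b], diagonalized: [phi2 = 1 - rho] and
   [v2] is the squared norm of [V]. *)
Definition block_form (R : fieldType) (phi2 C tau2 v2 a b c d : R) : R :=
  phi2 * (a + b + C * (c + d)) ^+ 2 / 2 + (2 - phi2) * (a - b) ^+ 2 / 2
  + tau2 * (c + d) ^+ 2 + v2 * (c - d) ^+ 2.

(** With [s = c + d], [z] is [(a + b + C * s) / 2] times [x + y], plus [(a - b) / 2] times [x - y],
    plus [s] times [u], plus [c - d] times [v]. These four vectors are orthogonal, and the first two
    have squared norms [2 * phi2] and [2 * (2 - phi2)]. *)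
Lemma block_form_dot (R : realType) (n : nat) (x y u v : 'cV[R]_n)
    (phi2 C a b c d : R) :
  dot x x = 1 -> dot y y = 1 -> dot x y = phi2 - 1 ->
  dot u x = 0 -> dot u y = 0 -> dot v x = 0 -> dot v y = 0 -> dot u v = 0 ->
  let w1 := (C / 2) *: (x + y) + u + v in
  let w2 := (C / 2) *: (x + y) + u - v in
  let z := a *: x + b *: y + c *: w1 + d *: w2 in
  dot z z = block_form phi2 C (dot u u) (dot v v) a b c d.
Proof.
move=> xx yy xy ux uy vx vy uv /=; rewrite -scaleN1r.
rewrite !(dotDl, dotDr, dotZl, dotZr) (dotC y x) (dotC v u).
rewrite (dotC x u) (dotC x v) (dotC y u) (dotC y v).
by rewrite xx yy xy ux uy vx vy uv /block_form; field.
Qed.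

Lemma weighted_sqr_ge0 (R : realDomainType) (w x : R) :
  0 <= w -> 0 <= w * x ^+ 2.
Proof. by move=> w0; rewrite mulr_ge0 ?sqr_ge0. Qed.

Section BlockForm.
Context {R : realFieldType}.

(* Up to sign, [`|a| + `|b|] is [a + b] or [a - b]; in the second case
   [2 - phi2 > phi2] leaves room to spare. *)
Lemma block_form_dual (phi2 C tau2 v2 a b c d t : R) :
  0 < phi2 < 1 -> 0 < tau2 -> 0 < v2 -> 0 <= t ->
  2 * t * (`|a| + `|b|) - t ^+ 2 * (2 * (1 / phi2) + C ^+ 2 / tau2)
    <= block_form phi2 C tau2 v2 a b c d.
Proof.
move=> /andP[phi2_gt0 phi2_lt1] tau2_gt0 v2_gt0 t0; set G := 2 * (1 / phi2) + _.
(* The sign of [u] is left free, so that [u = t] and [u = - t] cover both signs of [a + b], and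
   likewise of [a - b] below. *)
have same_sign u : 2 * u * (a + b) - u ^+ 2 * G
    <= block_form phi2 C tau2 v2 a b c d.
  rewrite -subr_ge0.
  rewrite (_ : _ - _ =
      (2 * phi2)^-1 * (phi2 * (a + b + C * (c + d)) - 2 * u) ^+ 2
      + tau2^-1 * (tau2 * (c + d) + u * C) ^+ 2
      + (2 - phi2) / 2 * (a - b) ^+ 2 + v2 * (c - d) ^+ 2); last first.
    by rewrite /G /block_form; field; rewrite !gt_eqF.
  by repeat apply: addr_ge0; apply: weighted_sqr_ge0; rewrite ?invr_ge0; lra.
have opposite_sign u : 2 * u * (a - b) - u ^+ 2 * G
    <= block_form phi2 C tau2 v2 a b c d.
  rewrite -subr_ge0.
  (* The weight [(2 - phi2) / 2] of [(a - b) ^+ 2] splits into [phi2 / 2], which absorbs the linear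
     term, and the nonnegative rest [1 - phi2]. *)
  rewrite (_ : _ - _ =
      (2 * phi2)^-1 * (phi2 * (a - b) - 2 * u) ^+ 2 + (1 - phi2) * (a - b) ^+ 2
      + phi2 / 2 * (a + b + C * (c + d)) ^+ 2 + tau2 * (c + d) ^+ 2
      + tau2^-1 * (u * C) ^+ 2 + v2 * (c - d) ^+ 2); last first.
    by rewrite /G /block_form; field; rewrite !gt_eqF.
  by repeat apply: addr_ge0; apply: weighted_sqr_ge0; rewrite ?invr_ge0; lra.
have := (same_sign t, same_sign (- t), opposite_sign t, opposite_sign (- t)).
rewrite sqrrN => -[[[]]].
by case: (ger0P a); case: (ger0P b); lra.
Qed.

(** Equality case of [block_form_dual]: here [a = b], [c = d], [c + d = - (C * t / tau2)] and
    [a + b + C * (c + d) = 2 * t / phi2], so every square in the same-sign decomposition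
    vanishes. *)
Lemma block_form_dual_attained (phi2 C tau2 v2 t : R) :
  0 < phi2 -> 0 < tau2 ->
  let G := 2 * (1 / phi2) + C ^+ 2 / tau2 in
  let c := - (C * t / (2 * tau2)) in
  block_form phi2 C tau2 v2 (t * G / 2) (t * G / 2) c c = t ^+ 2 * G.
Proof.
by move=> phi2_gt0 tau2_gt0; rewrite /block_form /=; field; rewrite !gt_eqF.
Qed.

(* What is left of the block Lasso objective, with all signs taken positive,
   after completing the squares. *)
Definition block_gap (phi2 C tau2 v2 lambda a b c d : R) : R :=
  phi2 / 2 * (a + b + C * (c + d) + 2 * lambda / phi2) ^+ 2
  + tau2 * (c + d - lambda * (C - 1) / tau2) ^+ 2
  + (2 - phi2) / 2 * (a - b) ^+ 2 + v2 * (c - d) ^+ 2.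

(** The first square absorbs [2 * lambda * (a + b + C * (c + d))]. What remains of the linear term
    is [- 2 * lambda * (C - 1) * (c + d)], absorbed by the square weighted by [tau2]. *)
Lemma block_form_gap (phi2 C tau2 v2 lambda a b c d : R) :
  0 < phi2 -> 0 < tau2 ->
  block_form phi2 C tau2 v2 a b c d + 2 * lambda * (a + b + c + d) =
  block_gap phi2 C tau2 v2 lambda a b c d
  - (2 * lambda ^+ 2 / phi2 + (lambda * (C - 1)) ^+ 2 / tau2).
Proof.
move=> phi2_gt0 tau2_gt0.
by rewrite /block_form /block_gap; field; rewrite !gt_eqF.
Qed.

Lemma block_gap_ge0 (phi2 C tau2 v2 lambda a b c d : R) :
  0 < phi2 < 1 -> 0 < tau2 -> 0 < v2 ->
  0 <= block_gap phi2 C tau2 v2 lambda a b c d.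
Proof.
move=> /andP[phi2_gt0 phi2_lt1] tau2_gt0 v2_gt0.
by repeat apply: addr_ge0; apply: weighted_sqr_ge0; lra.
Qed.

Lemma block_gap_eq0 (phi2 C tau2 v2 lambda : R) :
  0 < phi2 -> 0 < tau2 ->
  let a := - (lambda / phi2 + lambda * C * (C - 1) / (2 * tau2)) in
  let c := lambda * (C - 1) / (2 * tau2) in
  block_gap phi2 C tau2 v2 lambda a a c c = 0.
Proof.
by move=> phi2_gt0 tau2_gt0; rewrite /block_gap /=; field; rewrite !gt_eqF.
Qed.

(** The zero of the gap fixes [c = d] and their sum, hence the value. The correction [- 1 / tau2]
    comes from [(C - 1) ^+ 2 + 2 * (C - 1) = C ^+ 2 - 1]. *)
Lemma block_value (phi2 C tau2 v2 lambda a b c d : R) :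
  0 < phi2 < 1 -> 0 < tau2 -> 0 < v2 -> 0 <= lambda -> 1 <= C ->
  block_gap phi2 C tau2 v2 lambda a b c d = 0 ->
  block_form phi2 C tau2 v2 a b c d + 2 * lambda * (`|c| + `|d|) =
  lambda ^+ 2 * (2 * (1 / phi2) + C ^+ 2 / tau2) - lambda ^+ 2 * (1 / tau2).
Proof.
move=> /andP[phi2_gt0 phi2_lt1] tau2_gt0 v2_gt0 l0 C1 gap0.
have sq0 (w x : R) : 0 < w -> w * x ^+ 2 <= 0 -> x = 0.
  move=> w0; rewrite pmulr_rle0 // => x0.
  by apply/eqP; rewrite -sqrf_eq0 eq_le x0 sqr_ge0.
have h1 : 0 <= phi2 / 2 * (a + b + C * (c + d) + 2 * lambda / phi2) ^+ 2.
  by apply: weighted_sqr_ge0; lra.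
have h2 : 0 <= tau2 * (c + d - lambda * (C - 1) / tau2) ^+ 2.
  by apply: weighted_sqr_ge0; lra.
have h3 : 0 <= (2 - phi2) / 2 * (a - b) ^+ 2.
  by apply: weighted_sqr_ge0; lra.
have h4 : 0 <= v2 * (c - d) ^+ 2 by apply: weighted_sqr_ge0; lra.
move: gap0; rewrite /block_gap => gap0.
have e1 : a + b + C * (c + d) + 2 * lambda / phi2 = 0.
  by apply: (sq0 (phi2 / 2)); lra.
have e2 : c + d - lambda * (C - 1) / tau2 = 0 by apply: (sq0 tau2); lra.
have e3 : a - b = 0 by apply: (sq0 ((2 - phi2) / 2)); lra.
have e4 : c - d = 0 by apply: (sq0 v2); lra.
have s0 : 0 <= lambda * (C - 1) / tau2.
  by rewrite divr_ge0 ?mulr_ge0 //; lra.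
have [c0 d0] : 0 <= c /\ 0 <= d by split; lra.
rewrite !ger0_norm // /block_form e3 e4.
have -> : a + b + C * (c + d) = - (2 * lambda / phi2) by lra.
have -> : c + d = lambda * (C - 1) / tau2 by lra.
by field; rewrite !gt_eqF.
Qed.

End BlockForm.

(** * Summing over blocks: effective sparsity and Lasso *)

Section BlockDesign.
Context {R : realType} {n N : nat}.
Variables (X : 'M[R]_(n, 4 * N)) (phi2 C tau2 v2 : 'I_N -> R).
Hypotheses (phi2_bd : forall k, 0 < phi2 k < 1) (C_gt1 : forall k, 1 < C k).
Hypotheses (tau2_gt0 : forall k, 0 < tau2 k) (v2_gt0 : forall k, 0 < v2 k).
Hypothesis normX : forall b, l2norm (X *m b) ^+ 2 =
  \sum_k block_form (phi2 k) (C k) (tau2 k) (v2 k) (b (act1 k) ord0)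
    (b (act2 k) ord0) (b (inact1 k) ord0) (b (inact2 k) ord0).

Let S0 := [set j : 'I_(4 * N) | (j < 2 * N)%N]%SET.
Let G k := 2 * (1 / phi2 k) + C k ^+ 2 / tau2 k.

Let phi2_gt0 k : 0 < phi2 k. Proof. by case/andP: (phi2_bd k). Qed.

Let C_gt0 k : 0 < C k. Proof. exact: lt_trans (C_gt1 k). Qed.

Let G_gt0 k : 0 < G k.
Proof. by rewrite addr_gt0 ?mulr_gt0 ?divr_gt0 ?invr_gt0 ?exprn_gt0. Qed.

Lemma effective_sparsity_block : effective_sparsity X S0 = \sum_k G k.
Proof.
(* For [N = 0] both sides are 0, the left one because its numerator [#|S0|] is 0. *)
have [N0|/existsP[k0 _]] := boolP [forall k : 'I_N, false].
  have noI (k : 'I_N) : False by move/forallP/(_ k): N0.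
  rewrite big1 => [|k]; last by case: (noI k).
  rewrite /effective_sparsity (_ : S0 = finset.set0) ?cards0 ?mul0r //.
  apply/setP => j; rewrite !inE; apply/negbTE/negP => j2N.
  by apply: noI; exists j./2; lia.
set g := \sum_k G k.
have g0 : 0 < g.
  by rewrite /g (bigD1 k0) //= ltr_wpDr // sumr_ge0 // => k _; exact: ltW.
have S0n0 : S0 != finset.set0.
  by apply/set0Pn; exists (act1 k0); rewrite inE act_lt.
have S0_gt0 : 0 < #|S0|%:R :> R by rewrite ltr0n card_gt0.
have [b [b1 _] [E minE]] := compat_const_min X S0n0.
(* This [t] maximizes [2 * t - t ^+ 2 * g], the bound that [block_form_dual] yields on the feasible
   set; the maximum is [t] itself. *)
pose t := g^-1; have t0 : 0 < t by rewrite invr_gt0.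
suff cE : compat_const X S0 = #|S0|%:R * t.
  by rewrite /effective_sparsity cE invfM mulrA divff ?lt0r_neq0 // mul1r invrK.
apply/eqP; rewrite eq_le; apply/andP; split; last first.
  rewrite E ler_pM2l // normX.
  have -> : t = 2 * t * l1norm (restrict_to S0 b) - t ^+ 2 * g.
    by rewrite b1 /t; field; rewrite lt0r_neq0.
  rewrite l1norm_active !mulr_sumr -sumrB; apply: ler_sum => k _.
  by apply: block_form_dual => //; exact: ltW.
(* For the upper bound, [w] takes the equality point of [block_form_dual] in every block. *)
have [w wE] := block_col_exists (fun k => t * G k / 2) (fun k => t * G k / 2)
  (fun k => - (C k * t / (2 * tau2 k))) (fun k => - (C k * t / (2 * tau2 k))).
have -> : t = l2norm (X *m w) ^+ 2.
  transitivity (t ^+ 2 * g); first by rewrite /t; field; rewrite lt0r_neq0.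
  rewrite normX mulr_sumr; apply: eq_bigr => k _.
  by have [-> -> -> ->] := wE k; rewrite block_form_dual_attained.
apply: minE; split.
  rewrite l1norm_active; transitivity (t * g); last by rewrite mulVf ?lt0r_neq0.
  rewrite mulr_sumr; apply: eq_bigr => k _; have [-> -> _ _] := wE k.
  by rewrite ger0_norm ?divr_ge0 ?mulr_ge0 ?ltW //; lra.
rewrite l1norm_inactive; apply: (@le_trans _ _ (t * g)); last first.
  by rewrite mulVf ?lt0r_neq0.
rewrite mulr_sumr; apply: ler_sum => k _; have [_ _ -> ->] := wE k.
have ct0 : 0 < C k * t / (2 * tau2 k) by rewrite divr_gt0 ?mulr_gt0.
rewrite normrN gtr0_norm //.
have -> : C k * t / (2 * tau2 k) + C k * t / (2 * tau2 k) = t * (C k / tau2 k).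
  by field; rewrite lt0r_neq0.
(* [C k <= C k ^+ 2] bounds the inactive mass by the second term of [G k]. *)
rewrite ler_pM2l // /G -[leLHS]add0r.
rewrite lerD ?mulr_ge0 ?divr_ge0 ?invr_ge0 ?(ltW (phi2_gt0 k)) //.
by rewrite ler_pM2r ?invr_gt0 // expr2 ler_pMr // ltW.
Qed.

Lemma noiseless_lasso_block (beta0 : 'cV[R]_(4 * N)) (lambda : R) betastar :
  active_set beta0 = S0 -> 0 < lambda ->
  (forall k, lambda / phi2 k + lambda * C k * (C k - 1) / (2 * tau2 k)
     <= beta0 (act2 k) ord0 <= beta0 (act1 k) ord0) ->
  noiseless_lasso X beta0 lambda betastar ->
  l2norm (X *m (betastar - beta0)) ^+ 2
    + 2 * lambda * l1norm (restrict_to (~: S0)%SET betastar) =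
  lambda ^+ 2 * (\sum_k G k) - lambda ^+ 2 * (\sum_k 1 / tau2 k).
Proof.
move=> act0 l0 beta0_ge opt.
have inact0 k : beta0 (inact1 k) ord0 = 0 /\ beta0 (inact2 k) ord0 = 0.
  have I j : beta0 j ord0 != 0 = (j < 2 * N)%N.
    by have := congr1 (fun S : {set _} => j \in S) act0; rewrite !inE.
  by split; apply/eqP/negbFE; rewrite I act_lt.
pose gap (b : 'cV[R]_(4 * N)) k := block_gap (phi2 k) (C k) (tau2 k) (v2 k) lambda
  (b (act1 k) ord0 - beta0 (act1 k) ord0) (b (act2 k) ord0 - beta0 (act2 k) ord0)
  (b (inact1 k) ord0) (b (inact2 k) ord0).
have gap_ge0 b k : 0 <= gap b k by exact: block_gap_ge0.
(* The constant part of the objective; the terms in [beta0] appear because the gap is taken in the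
   deviations from [beta0], while the l1 norm is not. *)
pose K k := 2 * lambda * (beta0 (act1 k) ord0 + beta0 (act2 k) ord0)
  - (2 * lambda ^+ 2 / phi2 k + (lambda * (C k - 1)) ^+ 2 / tau2 k).
(* The cost of replacing each absolute value by the coordinate itself. *)
pose slack (b : 'cV[R]_(4 * N)) k := 2 * lambda *
  ((`|b (act1 k) ord0| - b (act1 k) ord0) + (`|b (act2 k) ord0| - b (act2 k) ord0)
  + (`|b (inact1 k) ord0| - b (inact1 k) ord0)
  + (`|b (inact2 k) ord0| - b (inact2 k) ord0)).
have slack_ge0 b k : 0 <= slack b k.
  have le_norm j := ler_norm (b j ord0).
  apply: mulr_ge0; first by lra.
  move: (le_norm (act1 k)) (le_norm (act2 k)).
  by move: (le_norm (inact1 k)) (le_norm (inact2 k)); lra.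
have objE b : lasso_obj X beta0 lambda b = \sum_k (gap b k + slack b k + K k).
  rewrite /lasso_obj normX l1norm_block mulr_sumr -big_split /=.
  apply: eq_bigr => k _; rewrite !mxE; have [-> ->] := inact0 k; rewrite !subr0.
  have := block_form_gap (C k) (v2 k) lambda
    (b (act1 k) ord0 - beta0 (act1 k) ord0) (b (act2 k) ord0 - beta0 (act2 k) ord0)
    (b (inact1 k) ord0) (b (inact2 k) ord0) (phi2_gt0 k) (tau2_gt0 k).
  by rewrite /gap /slack /K; lra.
pose x k := lambda / phi2 k + lambda * C k * (C k - 1) / (2 * tau2 k).
have x_ge0 k : 0 <= x k.
  have C1 := C_gt1 k.
  by rewrite addr_ge0 ?divr_ge0 ?mulr_ge0 ?ltW //; lra.
have c_ge0 k : 0 <= lambda * (C k - 1) / (2 * tau2 k).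
  by rewrite divr_ge0 ?mulr_ge0 ?subr_ge0 ?ltW.
(* The common zero of the squares: active coordinates are shifted down by [x k], and stay
   nonnegative by the lower bound on [beta0]. Gap and slack thus vanish at [w]. *)
have [w wE] := block_col_exists
  (fun k => beta0 (act1 k) ord0 - x k) (fun k => beta0 (act2 k) ord0 - x k)
  (fun k => lambda * (C k - 1) / (2 * tau2 k))
  (fun k => lambda * (C k - 1) / (2 * tau2 k)).
have gap0 : \sum_k gap betastar k <= 0.
  (* Comparison with [w] bounds the objective at [betastar] by the sum of the [K k], leaving no room
     for a positive gap. *)
  have := opt w; rewrite !objE.
  have -> : \sum_k (gap w k + slack w k + K k) = \sum_k K k.
    apply: eq_bigr => k _; rewrite /gap /slack; have [-> -> -> ->] := wE k.
    have xE (y : R) : y - x k - y = - x k by lra.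
    rewrite !xE [block_gap _ _ _ _ _ _ _ _ _]block_gap_eq0 // add0r.
    have /andP[h1 h2] := beta0_ge k; rewrite -/(x k) in h1.
    rewrite !ger0_norm ?subr_ge0 //; first by rewrite !subrr !addr0 mulr0 add0r.
    exact: le_trans h1 h2.
  rewrite big_split /= gerDr; apply: le_trans.
  by apply: ler_sum => k _; rewrite lerDl.
have {}gap0 k : gap betastar k = 0.
  have /eqP : \sum_k gap betastar k = 0.
    by apply/eqP; rewrite eq_le gap0 sumr_ge0.
  by rewrite psumr_eq0 // => /allP/(_ k (mem_index_enum _))/eqP.
rewrite normX l1norm_inactive !mulr_sumr -big_split /= -sumrB.
apply: eq_bigr => k _; rewrite !mxE.
have [-> ->] := inact0 k; rewrite !subr0.
by apply: block_value (gap0 k) => //; exact: ltW.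
Qed.

End BlockDesign.

(** * Deriving the block structure from the design *)

Theorem lemma13p1 (R : realType) (n N : nat) (X : 'M[R]_(n, 4 * N))
    (beta0 : 'cV[R]_(4 * N)) (S0 : {set 'I_(4 * N)})
    (rho phi2 C tau2 : 'I_N -> R) (U V : 'I_N -> 'cV[R]_n)
    (hX : fair_design X)
    (hS0 : S0 = [set j : 'I_(4 * N) | (j < 2 * N)%N]%SET)
    (hbeta0 : active_set beta0 = S0)
    (hgram : forall k : 'I_N,
       let Xk := row_mx (col (act1 k) X) (col (act2 k) X) in
       Xk^T *m Xk =
       block_mx (1%:M : 'M[R]_1) (- rho k)%:M (- rho k)%:M (1%:M : 'M[R]_1))
    (hphi2 : forall k, phi2 k = 1 - rho k)
    (hrho : forall k, 0 < rho k < 1)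
    (horth : forall (k : 'I_N) (j : 'I_(4 * N)),
       j \in S0 -> j != act1 k -> j != act2 k ->
       dot (col (act1 k) X) (col j X) = 0 /\
       dot (col (act2 k) X) (col j X) = 0)
    (hX1 : forall k, col (inact1 k) X =
       (C k / 2) *: (col (act1 k) X + col (act2 k) X) + U k + V k)
    (hX2 : forall k, col (inact2 k) X =
       (C k / 2) *: (col (act1 k) X + col (act2 k) X) + U k - V k)
    (hC : forall k, 1 < C k /\ C k ^+ 2 * phi2 k / 2 < 1)
    (hUVX : forall (k : 'I_N) (j : 'I_(4 * N)), j \in S0 ->
       dot (U k) (col j X) = 0 /\ dot (V k) (col j X) = 0)
    (hUVne : forall k j : 'I_N, j != k ->
       [/\ dot (U k) (U j) = 0, dot (U k) (V j) = 0,
           dot (V k) (U j) = 0 & dot (V k) (V j) = 0])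
    (hUV : forall k, dot (U k) (V k) = 0)
    (htau2 : forall k, tau2 k = dot (U k) (U k))
    (htau2_bd : forall k, 0 < tau2 k < 1 - C k ^+ 2 * phi2 k / 2) :
  effective_sparsity X S0 =
    2 * (\sum_k 1 / phi2 k) + \sum_k C k ^+ 2 / tau2 k /\
  (forall lambda : R, 0 < lambda ->
   (forall k : 'I_N,
      lambda / phi2 k + lambda * C k * (C k - 1) / (2 * tau2 k)
        <= beta0 (act2 k) ord0 <= beta0 (act1 k) ord0) ->
   forall betastar : 'cV[R]_(4 * N),
     noiseless_lasso X beta0 lambda betastar ->
     l2norm (X *m (betastar - beta0)) ^+ 2
       + 2 * lambda * l1norm (restrict_to (~: S0)%SET betastar)
     = lambda ^+ 2 * effective_sparsity X S0
       - lambda ^+ 2 * (\sum_k 1 / tau2 k)).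
Proof.
have act_S0 k : act1 k \in S0 /\ act2 k \in S0 by rewrite hS0 !inE !act_lt.
have gram k : [/\ dot (col (act1 k) X) (col (act1 k) X) = 1,
    dot (col (act2 k) X) (col (act2 k) X) = 1 &
    dot (col (act1 k) X) (col (act2 k) X) = - rho k].
  have := hgram k; rewrite /= tr_row_mx mul_col_row => /eq_block_mx[g1 g2 _ g4].
  by rewrite /dot g1 g2 g4 !mxE.
pose v2 k := dot (V k) (V k).
pose W k (a b c d : R) := a *: col (act1 k) X + b *: col (act2 k) X
  + c *: col (inact1 k) X + d *: col (inact2 k) X.
have WE k a b c d :
    dot (W k a b c d) (W k a b c d) = block_form (phi2 k) (C k) (tau2 k) (v2 k) a b c d.
  have [[a1 a2] [g1 g2 g12]] := (act_S0 k, gram k).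
  have [[u1 v1] [u2 v2']] := (hUVX k _ a1, hUVX k _ a2).
  rewrite /W hX1 hX2 htau2; apply: block_form_dot => //.
  by rewrite g12 hphi2; lra.
(* The coefficients [(0, 0, 1, 0)] single out the column [inact1 k], whose unit norm determines
   [v2 k]; the upper bound on [tau2 k] then makes it positive. *)
have v2E k : v2 k = 1 - C k ^+ 2 * phi2 k / 2 - tau2 k.
  have := WE k 0 0 1 0; rewrite /W !scale0r scale1r !add0r addr0 -l2norm_dot.
  by rewrite hX.1 /block_form => /esym; nra.
have phi2_bd k : 0 < phi2 k < 1 by have := hrho k; rewrite hphi2; lra.
have tau2_gt0 k : 0 < tau2 k by case/andP: (htau2_bd k).
have v2_gt0 k : 0 < v2 k by rewrite v2E; have := htau2_bd k; lra.
have C_gt1 k : 1 < C k by case: (hC k).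
(* By bilinearity every cross term is an inner product between different blocks, or of some [U] or
   [V] with an active column, and all of these vanish. *)
have W_orth k l a b c d a' b' c' d' : k != l ->
    dot (W k a b c d) (W l a' b' c' d') = 0.
  move=> kl; have [k1 k2] := act_S0 k; have [l1 l2] := act_S0 l.
  have [uk1 vk1] := hUVX l _ k1; have [uk2 vk2] := hUVX l _ k2.
  have [ul1 vl1] := hUVX k _ l1; have [ul2 vl2] := hUVX k _ l2.
  have ne : (k != l :> nat) by [].
  have [x11 x21] : dot (col (act1 k) X) (col (act1 l) X) = 0 /\
      dot (col (act2 k) X) (col (act1 l) X) = 0.
    by apply: horth => //; apply/eqP => /(congr1 val) /=; lia.
  have [x12 x22] : dot (col (act1 k) X) (col (act2 l) X) = 0 /\
      dot (col (act2 k) X) (col (act2 l) X) = 0.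
    by apply: horth => //; apply/eqP => /(congr1 val) /=; lia.
  have [uu uv vu vv] : [/\ dot (U k) (U l) = 0, dot (U k) (V l) = 0,
      dot (V k) (U l) = 0 & dot (V k) (V l) = 0] by apply: hUVne; rewrite eq_sym.
  rewrite /W !hX1 !hX2 -!scaleN1r !(dotDl, dotDr, dotZl, dotZr).
  rewrite x11 x12 x21 x22 uu uv vu vv ul1 ul2 vl1 vl2.
  rewrite !(dotC _ (U l)) !(dotC _ (V l)) uk1 uk2 vk1 vk2.
  by rewrite !(mulr0, addr0).
have normX b : l2norm (X *m b) ^+ 2 =
    \sum_k block_form (phi2 k) (C k) (tau2 k) (v2 k) (b (act1 k) ord0)
      (b (act2 k) ord0) (b (inact1 k) ord0) (b (inact2 k) ord0).
  have -> : X *m b = \sum_k W k (b (act1 k) ord0) (b (act2 k) ord0)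
      (b (inact1 k) ord0) (b (inact2 k) ord0).
    rewrite -(sum_block (fun j => b j ord0 *: col j X)).
    apply/matrixP => i j; rewrite !mxE summxE; apply: eq_bigr => m _.
    by rewrite !mxE (ord1 j) mulrC.
  rewrite l2norm_dot dot_sum_orthogonal => [|k l kl]; last exact: W_orth.
  by apply: eq_bigr => k _; exact: WE.
have GE : \sum_k (2 * (1 / phi2 k) + C k ^+ 2 / tau2 k) =
    2 * (\sum_k 1 / phi2 k) + \sum_k C k ^+ 2 / tau2 k.
  by rewrite big_split /= mulr_sumr.
have sparsity : effective_sparsity X S0 =
    \sum_k (2 * (1 / phi2 k) + C k ^+ 2 / tau2 k).
  by rewrite hS0; apply: effective_sparsity_block normX.
split; first by rewrite sparsity.
move=> lambda l0 hb betastar opt; rewrite sparsity.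
by rewrite hS0 in hbeta0 *; apply: (noiseless_lasso_block phi2_bd C_gt1 tau2_gt0 v2_gt0 normX).
Qed.
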